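(* Let $f\in\mathbb{R}\langle\underline X\rangle$ be a noncommutative polynomial, let $h$ be a SOHS part of $f$, and let $\widetilde f$ be a SOHS extension of $f$. Then the following are equivalent: (1) $\widetilde f$ is a Gram-like matrix preserving extension of $f$ with respect to $h$ such that there exists a positive semidefinite Gram-like matrix $G_{\widetilde f}$ of $\widetilde f$ (realizing this property) of the form $$G_{\widetilde f}=\begin{pmatrix}G_h&0\\0&G_{\widetilde f-h}\end{pmatrix},$$ where $G_h$ and $G_{\widetilde f-h}$ are $k\times k$ and $l\times l$ positive semidefinite Gram-like matrices of $h$ and $\widetilde f-h$ respectively. (2) There exist representations $$h=\sum_{i=1}^k a_i\zeta_i^*\zeta_i+\sum_{1\le i<j\le k}b_{ij}(\zeta_i^*\zeta_j+\zeta_j^*\zeta_i),\qquad \widetilde f-h=\sum_{i=1}^l c_i\eta_i^*\eta_i+\sum_{1\le i<j\le l}d_{ij}(\eta_i^*\eta_j+\eta_j^*\eta_i),$$ both admissible SOHS representations, such that $\zeta_i\ne\eta_j$ for all $1\le i\le k$, $1\le j\le l$.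
   Context: Let $X_1,\dots,X_n$ be noncommuting variables, $\langle\underline X\rangle$ the free monoid of words (monomials, including $1$), $\mathbb{R}\langle\underline X\rangle$ the free real algebra, with the $\mathbb{R}$-linear involution $*$ fixing each $X_i$ and reversing words. The degree of a monomial is its length; the degree of a polynomial is that of its highest-degree monomials. A polynomial is SOHS if it is a finite sum $\sum_i g_i^*g_i$. For $W=(w_1,\dots,w_k)^t$ a vector of monomials, $W^*=(w_1^*,\dots,w_k^* )$. All variables are assumed essential to express $f$, and extensions lie in the same $\mathbb{R}\langle\underline X\rangle$. A SOHS part of $f$ is a SOHS polynomial $h$ formed by collecting some of the terms of $f$. Positive semidefinite Gram-like matrix: if $p$ is a SOHS of degree $2d$, a $k\times k$ real positive semidefinite matrix $G$ is a positive semidefinite Gram-like matrix of $p$ if $p=W_k^*GW_k$ for some column vector $W_k$ of $k$ distinct monomials of degree at most $d$ (the associated monomial vector). Admissible SOHS representation of a polynomial $p$ of degree $2d$: an expression $p=\sum_{i=1}^k a_i\zeta_i^*\zeta_i+\sum_{1\le i<j\le k}b_{ij}(\zeta_i^*\zeta_j+\zeta_j^*\zeta_i)$ with $a_i,b_{ij}\in\mathbb{R}$, pairwise distinct monomials $\zeta_i$ of degree at most $d$, all $a_i>0$, and such that for every nonempty $K=\{i_1<\dots<i_{|K|}\}\subseteq\{1,\dots,k\}$ the symmetric matrix with diagonal entries $a_{i_1},\dots,a_{i_{|K|}}$ and off-diagonal entries $b_{i_pi_q}$ ($p<q$) is positive semidefinite. SOHS extension: if $f=\sum_{j=1}^m c_j\delta_j$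 with distinct monomials $\delta_j$ and $c_j\ne0$, a SOHS polynomial $\widetilde f$ is a (nontrivial) SOHS extension of $f$ if $\widetilde f-f=\sum_{i=1}^{N}b_i\alpha_i$ with monomials $\alpha_i$, $b_i\in\mathbb{R}\setminus\{0\}$ and $\alpha_i\ne\delta_j$ for all $i,j$. Gram-like matrix preserving extension: a SOHS extension $\widetilde f$ of $f$ is a Gram-like matrix preserving extension with respect to a SOHS part $h$ of $f$ if there are integers $s>k>0$, an $s\times s$ positive semidefinite Gram-like matrix $G_{\widetilde f}$ of $\widetilde f$ having a $k\times k$ positive semidefinite Gram-like matrix $G_h$ of $h$ as a principal submatrix, and associated monomial vectors $W_s$ of $G_{\widetilde f}$ and $W_k$ of $G_h$ such that $W_s$ contains all entries of $W_k$ (those entries labelling the rows of the principal submatrix $G_h$). *)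

(* Defs.v *)
From HB Require Import structures.
From mathcomp Require Import all_boot all_order all_algebra.
From mathcomp Require Import finmap reals.
From mathcomp Require Import monalg.

Set Implicit Arguments.
Unset Strict Implicit.
Unset Printing Implicit Defensive.

Import Order.TTheory GRing.Theory Num.Theory.

Local Open Scope fset_scope.
Local Open Scope ring_scope.

(* Words in X_1, ..., X_n are the elements of the free monoid on 'I_n, and
   R<X> is its monoid algebra. In monalg, p@_w is the coefficient of w in p,
   msupp p is the finite set of words with nonzero coefficient, << w >> is the
   word w as a polynomial and << c *g w >> is c times that polynomial. *)
Notation word n := {fmonom 'I_n} (only parsing).
Notation ncpoly R n := {malg R[{fmonom 'I_n}]} (only parsing).

Section FreeAlgebra.
Variables (R : realType) (n : nat).
Implicit Types (f h ft p : ncpoly R n) (w : word n).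

Definition revw w : word n := FMonom (rev w).

Definition star p : ncpoly R n := \sum_(w <- msupp p) << p@_w *g revw w >>.

(* mmeasure fdeg p is 1 + the degree of p, and is 0 for p = 0. Hence the zero
   polynomial has no degree. *)
Definition has_degree p (m : nat) : Prop := mmeasure (@fdeg 'I_n) p = m.+1.

Definition sohs p : Prop :=
  exists gs : seq (ncpoly R n), p = \sum_(g <- gs) star g * g.

Definition all_vars_essential f : Prop :=
  forall i : 'I_n, exists2 w, w \in msupp f & i \in (w : seq 'I_n).

Definition sohs_part f h : Prop :=
  sohs h /\
  exists2 T : {fset word n}, T `<=` msupp f &
    h = \sum_(w <- T) << f@_w *g w >>.

(* The condition ft <> f is nontriviality: at least one term is added. *)
Definition sohs_extension f ft : Prop :=
  [/\ sohs ft, ft <> f & [disjoint msupp (ft - f) & msupp f]].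

Definition psd k (A : 'M[R]_k) : Prop :=
  A^T = A /\ forall x : 'cV[R]_k, 0 <= (x^T *m A *m x) 0 0.

Definition monvec k (W : 'cV[word n]_k) : 'cV[ncpoly R n]_k :=
  map_mx (fun w => << w >>) W.

Definition monvec_star k (W : 'cV[word n]_k) : 'rV[ncpoly R n]_k :=
  map_mx star (monvec W)^T.

Definition gram_like p k (G : 'M[R]_k) (W : 'cV[word n]_k) : Prop :=
  [/\ sohs p,
      psd G,
      injective (fun i => W i ord0),
      exists2 d : nat, has_degree p d.*2 &
        forall i, (fdeg (W i ord0) <= d)%N
    & p = (monvec_star W *m map_mx (fun c => c%:MP) G *m monvec W) 0 0].

(* The map phi is the increasing enumeration of the rows (and columns) of Gs
   that form the principal submatrix Gh. *)
Definition gram_preserving_via h ft s k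
    (Gs : 'M[R]_s) (Ws : 'cV[word n]_s) (Gh : 'M[R]_k) (Wk : 'cV[word n]_k)
    (phi : 'I_k -> 'I_s) : Prop :=
  [/\ (0 < k < s)%N,
      gram_like ft Gs Ws,
      gram_like h Gh Wk,
      {homo phi : i j / (i < j)%N}
    & mxsub phi phi Gs = Gh /\ rowsub phi Ws = Wk].

Definition gram_preserving_extension f h ft : Prop :=
  [/\ sohs_part f h, sohs_extension f ft
    & exists s k (Gs : 'M[R]_s) (Ws : 'cV[word n]_s)
        (Gh : 'M[R]_k) (Wk : 'cV[word n]_k) (phi : 'I_k -> 'I_s),
        gram_preserving_via h ft Gs Ws Gh Wk phi].

(* Only the entries b i j with i < j are used. *)
Definition coef_mx k (a : 'I_k -> R) (b : 'I_k -> 'I_k -> R) : 'M[R]_k :=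
  \matrix_(i, j)
    if i == j then a i else if (i < j)%N then b i j else b j i.

Definition admissible_rep p k (zeta : 'I_k -> word n)
    (a : 'I_k -> R) (b : 'I_k -> 'I_k -> R) : Prop :=
  let z i : ncpoly R n := << zeta i >> in
  [/\ p = \sum_(i < k) a i *: (star (z i) * z i)
        + \sum_(i < k) \sum_(j < k | (i < j)%N)
            b i j *: (star (z i) * z j + star (z j) * z i),
      injective zeta,
      exists2 d : nat, has_degree p d.*2 & forall i, (fdeg (zeta i) <= d)%N,
      forall i, 0 < a i
    & forall K : {set 'I_k}, K != set0 ->
        psd (mxsub (@enum_val _ (mem K)) (@enum_val _ (mem K)) (coef_mx a b))].

End FreeAlgebra.

(* Main.v *)
Require Import Defs.
From mathcomp Require Import all_boot all_order all_algebra.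
From mathcomp Require Import finmap reals.
From mathcomp Require Import monalg.

(** Both conditions speak of one object: a polynomial
      gram_poly G z = sum_(i, j) G_ij z_i^* z_j
    attached to a real symmetric matrix G and pairwise distinct words z_i. A
    Gram-like matrix allows zeros on the diagonal of G, whereas an admissible
    representation lists the diagonal and the upper triangle of G and requires
    a positive diagonal.

    From matrices to representations: a zero diagonal entry of a positive
    semidefinite matrix forces its whole row and column to vanish (psd_diag0),
    so the words with zero diagonal entry can be discarded without changing
    the polynomial (gram_poly_support). Doing this separately in the two
    diagonal blocks gives the two representations; their words stay different
    because the words labelling the block matrix are pairwise distinct.

    From representations to matrices: the coefficient matrices are positive
    semidefinite (take for K the full index set), and the block diagonal matrix
    represents h + (ft - h) = ft on the concatenated words, which are distinct
    by hypothesis. There are two points left.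
    - A polynomial with a positive semidefinite Gram matrix is SOHS (psd_sohs):
      factor G = B^T B, and each row of B gives one square.
    - The words must have length at most half the degree of ft, so the top
      terms of h and of ft - h must not cancel. Let w be a longest word among
      the z_i. The only way to write w^* w as z_i^* z_j is z_i = z_j = w
      (revw_mul_inj), so its coefficient is a diagonal entry of G, which is
      positive; hence the degree is exactly twice the length of w
      (gram_poly_degree). *)

Set Implicit Arguments.
Unset Strict Implicit.
Unset Printing Implicit Defensive.

Import Order.TTheory GRing.Theory Num.Theory.

Local Open Scope ring_scope.

(** * Real positive semidefinite matrices *)

Section RealPsd.
Variable R : realType.

Lemma psd_congr m k (P : 'M[R]_(m, k)) (A : 'M[R]_k) :
  psd A -> psd (P *m A *m P^T).
Proof.
move=> [sA pA]; split; first by rewrite !trmx_mul trmxK sA mulmxA.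
move=> x; have := pA (P^T *m x).
by rewrite trmx_mul trmxK !mulmxA.
Qed.

Lemma psd_mxsub m k (f : 'I_m -> 'I_k) (A : 'M[R]_k) :
  psd A -> psd (mxsub f f A).
Proof.
have -> : mxsub f f A = rowsub f 1%:M *m A *m (rowsub f 1%:M)^T.
  rewrite mul_rowsub_mx mul1mx trmx_mxsub trmx1 mulmx_colsub mulmx1.
  by rewrite -mxsub_comp.
exact: psd_congr.
Qed.

Lemma psd_block k l (A : 'M[R]_k) (B : 'M[R]_l) :
  psd A -> psd B -> psd (block_mx A 0 0 B).
Proof.
move=> [sA pA] [sB pB]; split; first by rewrite tr_block_mx sA sB !trmx0.
move=> x; rewrite -[x]vsubmxK tr_col_mx mul_row_block !mulmx0 addr0 add0r.
by rewrite mul_row_col mxE addr_ge0.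
Qed.

Lemma psd_diag_ge0 k (A : 'M[R]_k) i : psd A -> 0 <= A i i.
Proof.
move=> [_ /(_ (delta_mx i 0))].
by rewrite trmx_delta -rowE -colE !mxE.
Qed.

(** If A_ii = 0, the form takes the value 2 t A_ij + A_jj at t e_i + e_j. It is
    affine in t, hence negative for some t unless A_ij = 0. *)
Lemma psd_diag0 k (A : 'M[R]_k) i j : psd A -> A i i = 0 -> A i j = 0.
Proof.
move=> pA Aii0; apply/eqP/negP => /negP Aij0.
have sA : A j i = A i j by case: pA => {2}<- _; rewrite mxE.
(* This t makes the form equal to -1. *)
pose t := - (A j j + 1) / (2 * A i j).
have [_ /(_ (t *: delta_mx i 0 + delta_mx j 0))] := pA.
have -> : (t *: delta_mx i 0 + delta_mx j 0 : 'cV_k)^T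
          = t *: delta_mx 0 i + delta_mx 0 j.
  by rewrite linearD linearZ /= !trmx_delta.
rewrite !(mulmxDl, mulmxDr) -!scalemxAl -!scalemxAr.
rewrite -!rowE -!colE !mxE Aii0 sA mulr0 mulr0 add0r.
have -> : t * A i j + (t * A i j + A j j) = -1.
  rewrite addrA -mulr2n -mulr_natl mulrCA.
  by rewrite /t divfK ?mulf_neq0 ?pnatr_eq0 // opprD addrAC addNr add0r.
by rewrite lerNr oppr0 ler10.
Qed.

(** Induction on the size by Schur complement. The same formulas
    serve for a pivot a = 0: then the rest u of its column vanishes, and with
    0^-1 = 0 all the block identities still hold. *)
Lemma psd_factor k (A : 'M[R]_k) : psd A -> exists B : 'M[R]_k, A = B^T *m B.
Proof.
elim: k A => [|k IHk] A pA; first by exists 0; apply/matrixP => - [].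
pose a := A 0 0; pose u : 'cV_k := @dlsubmx _ 1 k 1 k A.
pose C : 'M_k := @drsubmx _ 1 k 1 k A.
have sA : A^T = A by case: pA.
have eA : A = block_mx (a%:M : 'M_1) u^T u C.
  have -> : u^T = @ursubmx _ 1 k 1 k A by rewrite trmx_dlsub sA.
  apply: etrans (esym (@submxK _ 1 k 1 k A)) _.
  apply: (f_equal4 (@block_mx R 1 k 1 k)) => //.
  apply/matrixP => i j; rewrite !ord1 !mxE eqxx mulr1n /a.
  by congr (A _ _); apply/val_inj.
have a_ge0 : 0 <= a by apply: psd_diag_ge0.
have u0 : a = 0 -> u = 0.
  move=> a0; apply/matrixP => i j; rewrite !mxE -sA mxE.
  apply: psd_diag0 => //; rewrite -[RHS]a0 /a.
  by congr (A _ _); apply/val_inj; rewrite /= ord1.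
pose S := C - a^-1 *: (u *m u^T).
have /IHk [B eS] : psd S.
  (* S is the congruence of A by the elimination matrix (-u / a, 1). *)
  have := psd_congr (row_mx (- a^-1 *: u) 1%:M : 'M_(k, 1 + k)) pA.
  rewrite eA tr_row_mx mul_row_block mul_row_col !mul1mx trmx1 mulmx1.
  have -> : - a^-1 *: u *m a%:M + u = 0.
    rewrite mul_mx_scalar scalerA mulrN.
    have [/u0->|a0] := eqVneq a 0; first by rewrite scaler0 addr0.
    by rewrite divff // scaleN1r addNr.
  by rewrite mul0mx add0r -scalemxAl scaleNr addrC.
pose r := Num.sqrt a.
have rr : r * r = a by rewrite -expr2 sqr_sqrtr.
exists (block_mx (r%:M : 'M_1) (r^-1 *: u^T) 0 B).
rewrite {1}eA (@tr_block_mx _ 1 k 1 k) (@mulmx_block _ 1 k 1 k 1 k).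
have -> : (r^-1 *: u^T)^T = r^-1 *: u by rewrite linearZ /= trmxK.
rewrite !trmx0 !mul0mx mulmx0 !addr0 tr_scalar_mx -eS.
have ru : r * r^-1 *: u = u.
  have [r0|r0] := eqVneq r 0; last by rewrite divff // scale1r.
  by rewrite u0 ?scaler0 // -rr r0 mulr0.
apply: (f_equal4 (@block_mx R 1 k 1 k)).
- by rewrite -scalar_mxM rr.
- by rewrite mul_scalar_mx scalerA -{1}ru linearZ.
- by rewrite mul_mx_scalar scalerA ru.
rewrite -scalemxAl -scalemxAr scalerA -invfM rr /S.
by rewrite addrC subrK.
Qed.

Lemma coef_mx_id k (A : 'M[R]_k) :
  A^T = A -> coef_mx (fun i => A i i) (fun i j => A i j) = A.
Proof.
move=> sA; apply/matrixP => i j; rewrite mxE; case: eqP => [->//|_].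
by case: ifP => // _; rewrite -{1}sA mxE.
Qed.

Lemma coef_mx_mxsub m k (f : 'I_m -> 'I_k) (A : 'M[R]_k) :
  A^T = A -> coef_mx (fun i => A (f i) (f i)) (fun i j => A (f i) (f j))
             = mxsub f f A.
Proof.
move=> sA; rewrite -[RHS]coef_mx_id ?trmx_mxsub ?sA //.
by apply/matrixP => i j; rewrite !mxE.
Qed.

(** The case K = setT. The rows of that submatrix are indexed by the cardinal
    of setT, so the matrix itself is recovered by reindexing once more. *)
Lemma psd_coef_mx k (a : 'I_k -> R) (b : 'I_k -> 'I_k -> R) :
  (0 < k)%N ->
  (forall K : {set 'I_k}, K != set0 ->
     psd (mxsub (@enum_val _ (mem K)) (@enum_val _ (mem K)) (coef_mx a b))) ->
  psd (coef_mx a b).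
Proof.
move=> k_gt0 pK; pose i0 := Ordinal k_gt0.
have /pK pT : [set: 'I_k] != set0 by apply/set0Pn; exists i0; rewrite inE.
pose g := @enum_rank_in _ i0 (mem [set: 'I_k]) (in_setT _).
have eg i : enum_val (g i) = i by rewrite enum_rankK_in ?inE.
have := psd_mxsub g pT; rewrite -mxsub_comp.
by congr psd; apply/matrixP => i j; rewrite !mxE /= !eg.
Qed.

End RealPsd.

(** * Polynomials with a prescribed Gram matrix *)

Lemma sum_square (V : zmodType) k (E : 'I_k -> 'I_k -> V) :
  \sum_(i < k) \sum_(j < k) E i j
  = \sum_(i < k) E i i + \sum_(i < k) \sum_(j < k | (i < j)%N) (E i j + E j i).
Proof.
under [X in _ + X]eq_bigr => i _ do rewrite big_split.
rewrite !big_split /= [X in _ = _ + (_ + X)](exchange_big_dep xpredT) //=.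
rewrite -!big_split /=.
apply: eq_bigr => i _.
rewrite (bigD1 i) //= (bigID (fun j : 'I_k => (i < j)%N)) /=.
congr (_ + (_ + _)); apply: eq_bigl => j; rewrite -val_eqE /=.
all: by case: ltngtP.
Qed.

Section GramPoly.
Variables (R : realType) (n : nat).
Local Notation word := {fmonom 'I_n}.
Local Notation ncpoly := {malg R[{fmonom 'I_n}]}.

Lemma revwK : involutive (@revw n).
Proof. by move=> w; rewrite /revw /= revK fmK. Qed.

Lemma fdeg_revw (w : word) : fdeg (revw w) = fdeg w.
Proof. by rewrite !fdegE size_rev. Qed.

Lemma mcoeff_star (p : ncpoly) w : (star p)@_w = p@_(revw w).
Proof.
rewrite {2}[p]monalgE /star !raddf_sum /=; apply: eq_bigr => v _.
by rewrite !mcoeffU (can2_eq revwK revwK).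
Qed.

Lemma star_sum (I : finType) (c : I -> R) (z : I -> word) :
  star (\sum_i << c i *g z i >>) = \sum_i << c i *g revw (z i) >>.
Proof.
apply/malgP => w; rewrite mcoeff_star !raddf_sum /=; apply: eq_bigr => i _.
by rewrite !mcoeffU (can2_eq revwK revwK).
Qed.

Lemma starU (w : word) : star (<< w >> : ncpoly) = << revw w >>.
Proof.
have := star_sum (fun _ : 'I_1 => 1) (fun _ => w).
by rewrite !big_ord1.
Qed.

Lemma malgUU (c d : R) (u v : word) :
  << c *g u >> * << d *g v >> = << c * d *g mmul u v >> :> ncpoly.
Proof. by rewrite malgM_def fgmulUU. Qed.

Lemma mul_sumU (I J : finType) (c : I -> R) (d : J -> R)
    (u : I -> word) (v : J -> word) :
  (\sum_i << c i *g u i >>) * (\sum_j << d j *g v j >>)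
  = \sum_i \sum_j << c i * d j *g mmul (u i) (v j) >> :> ncpoly.
Proof.
rewrite mulr_suml; apply: eq_bigr => i _; rewrite mulr_sumr.
by apply: eq_bigr => j _; rewrite malgUU.
Qed.

Lemma scale_malgU (c d : R) (u : word) :
  c *: << d *g u >> = << c * d *g u >> :> ncpoly.
Proof. by apply/malgP => w; rewrite mcoeffZ !mcoeffU mulrnAr. Qed.

Definition gram_poly k (G : 'M[R]_k) (z : 'I_k -> word) : ncpoly :=
  \sum_(i < k) \sum_(j < k) << G i j *g mmul (revw (z i)) (z j) >>.

Lemma gram_mxE k (G : 'M[R]_k) (W : 'cV[word]_k) :
  (monvec_star R W *m map_mx (fun c => c%:MP) G *m monvec R W) 0 0
  = gram_poly G (fun i => W i ord0).
Proof.
rewrite mxE /gram_poly exchange_big /=; apply: eq_bigr => j _.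
rewrite mxE mulr_suml; apply: eq_bigr => i _; rewrite !mxE starU.
by rewrite !malgUU mulr1 mul1r mulm1.
Qed.

Lemma rep_sumE k (z : 'I_k -> word) (a : 'I_k -> R) (b : 'I_k -> 'I_k -> R) :
  let m i : ncpoly := << z i >> in
  \sum_(i < k) a i *: (star (m i) * m i)
    + \sum_(i < k) \sum_(j < k | (i < j)%N)
        b i j *: (star (m i) * m j + star (m j) * m i)
  = gram_poly (coef_mx a b) z.
Proof.
move=> m; rewrite /gram_poly sum_square; congr (_ + _).
  by apply: eq_bigr => i _; rewrite /m starU malgUU scale_malgU !mulr1 mxE eqxx.
apply: eq_bigr => i _; apply: eq_bigr => j lt_ij.
rewrite /m !starU !malgUU scalerDr !scale_malgU !mulr1 !mxE.
rewrite -!val_eqE /= lt_ij (gtn_eqF lt_ij) (ltn_eqF lt_ij).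
by rewrite ltnNge (ltnW lt_ij).
Qed.

(** With G = B^T B, the squares are those of the sum_j B_rj z_j. *)
Lemma psd_sohs k (G : 'M[R]_k) (z : 'I_k -> word) :
  psd G -> sohs (gram_poly G z).
Proof.
move=> /psd_factor [B ->].
exists [seq \sum_(j < k) << B r j *g z j >> | r <- enum 'I_k].
rewrite big_map big_enum /=.
under [RHS]eq_bigr do rewrite star_sum mul_sumU.
rewrite [RHS]exchange_big /=; apply: eq_bigr => i _.
rewrite [RHS]exchange_big /=; apply: eq_bigr => j _.
by rewrite mxE raddf_sum; apply: eq_bigr => r _; rewrite mxE.
Qed.

(** No cancellation at the top: comparing lengths, both factors must be as long
    as w, and then the two concatenations split at the same place. *)
Lemma revw_mul_inj (u v w : word) :
  (fdeg u <= fdeg w)%N -> (fdeg v <= fdeg w)%N ->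
  mmul (revw u) v = mmul (revw w) w -> u = w /\ v = w.
Proof.
move=> lu lv e; have := congr1 (@fdeg _) e.
rewrite !fdegM !fdeg_revw => ed.
have eu : fdeg u = fdeg w.
  by apply/eqP; rewrite eqn_leq lu -(leq_add2r (fdeg w)) -ed leq_add2l.
have : mmul (revw u) v == mmul (revw w) w by rewrite e.
rewrite fmP !fmM eqseq_cat ?size_rev -?fdegE // => /andP[/eqP e1 /eqP e2].
split; last by apply/eqP; rewrite fmP; apply/eqP.
by apply/(can_inj revwK)/eqP; rewrite fmP; apply/eqP.
Qed.

(** Positivity of the diagonal makes the square of a longest word survive, so
    the degree can be read off from the words. *)
Lemma gram_poly_degree k (G : 'M[R]_k) (z : 'I_k -> word) :
  (0 < k)%N -> injective z -> (forall i, 0 < G i i) ->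
  has_degree (gram_poly G z) (\max_(i < k) fdeg (z i)).*2.
Proof.
move=> k_gt0 z_inj G_gt0; set d := \max_i _.
have le_d i : (fdeg (z i) <= d)%N by apply: leq_bigmax.
have [i0 ei0] : {i0 | d = fdeg (z i0)}.
  by apply: bigop.eq_bigmax; rewrite card_ord.
apply/eqP; rewrite eqn_leq; apply/andP; split.
  apply: leq_trans (mmeasure_sum _ _ _ _) _; apply/bigmax_leqP => i _.
  apply: leq_trans (mmeasure_sum _ _ _ _) _; apply/bigmax_leqP => j _.
  rewrite mmeasureE msuppU; case: ifP => _; first by rewrite big_seq_fset0.
  rewrite big_seq_fset1 ltnS /= fdegM fdeg_revw -addnn.
  by rewrite leq_add.
have -> : d.*2 = fdeg (mmul (revw (z i0)) (z i0)).
  by rewrite fdegM fdeg_revw addnn ei0.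
apply: mmeasure_mnm_lt; rewrite -mcoeff_neq0.
suff -> : (gram_poly G z)@_(mmul (revw (z i0)) (z i0)) = G i0 i0 by rewrite gt_eqF.
have coef i j : (i, j) != (i0, i0) ->
    (<< G i j *g mmul (revw (z i)) (z j) >>)@_(mmul (revw (z i0)) (z i0)) = 0.
  move=> ne; rewrite mcoeffU; case: eqP => // /revw_mul_inj [].
  - by rewrite -ei0.
  - by rewrite -ei0.
  by move=> /z_inj ei /z_inj ej; rewrite ei ej eqxx in ne.
rewrite raddf_sum (bigD1 i0) //= raddf_sum (bigD1 i0) //= mcoeffUU.
rewrite !big1 ?addr0 // => [i ne|j ne]; last first.
  by rewrite coef // xpair_eqE eqxx.
by rewrite raddf_sum big1 // => j _; apply: coef; rewrite xpair_eqE negb_and ne.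
Qed.

Lemma gram_poly0 (G : 'M[R]_0) (z : 'I_0 -> word) : gram_poly G z = 0.
Proof. by rewrite /gram_poly big_ord0. Qed.

Lemma gram_poly_block k l (G : 'M[R]_k) (H : 'M[R]_l) (z : 'I_(k + l) -> word) :
  gram_poly (block_mx G 0 0 H) z
  = gram_poly G (fun i => z (lshift l i)) + gram_poly H (fun i => z (rshift k i)).
Proof.
rewrite /gram_poly big_split_ord /=; congr (_ + _); apply: eq_bigr => i _.
  rewrite big_split_ord /= [X in _ + X]big1 ?addr0 => [|j _].
    by apply: eq_bigr => j _; rewrite block_mxEul.
  by rewrite block_mxEur mxE monalgU0.
rewrite big_split_ord /= [X in X + _]big1 ?add0r => [|j _].
  by apply: eq_bigr => j _; rewrite block_mxEdr.
by rewrite block_mxEdl mxE monalgU0.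
Qed.

(** By psd_diag0 the discarded words have no nonzero coefficient at all. This is
    how the positivity of the diagonal in an admissible representation is
    reached. *)
Lemma gram_poly_support k (G : 'M[R]_k) (z : 'I_k -> word) :
  psd G ->
  let S := [set i | G i i != 0] in
  let e := @enum_val _ (mem S) in
  gram_poly G z = gram_poly (mxsub e e G) (fun i => z (e i)).
Proof.
move=> pG S e; have sG : G^T = G by case: pG.
have G0 i j : i \notin S -> G i j = 0.
  by rewrite inE negbK => /eqP; apply: psd_diag0.
have sumS (F : 'I_k -> ncpoly) :
    (forall i, i \notin S -> F i = 0) -> \sum_i F i = \sum_i F (e i).
  move=> F0; rewrite (bigID (mem S)) /= [X in _ + X]big1 ?addr0 //.
  exact: big_enum_val.
rewrite /gram_poly sumS => [|i iS]; last first.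
  by rewrite big1 // => j _; rewrite G0 ?monalgU0.
apply: eq_bigr => i _; rewrite sumS => [|j jS].
  by apply: eq_bigr => j _; rewrite mxE.
by rewrite -sG mxE G0 ?monalgU0.
Qed.

(** * Gram-like matrices and admissible representations *)

Lemma has_degree_neq0 m : ~ has_degree (0 : ncpoly) m.
Proof. by rewrite /has_degree mmeasure0. Qed.

Lemma gram_like_admissible p k (G : 'M[R]_k) (W : 'cV[word]_k) :
  gram_like p G W ->
  exists m (zeta : 'I_m -> word) a b,
    admissible_rep p zeta a b /\ forall i, exists j, zeta i = W j ord0.
Proof.
move=> [_ pG W_inj [d degp Wd] ep]; have sG : G^T = G by case: pG.
pose e := @enum_val _ (mem [set i | G i i != 0]).
exists #|[set i | G i i != 0]|, (fun i => W (e i) ord0),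
  (fun i => G (e i) (e i)), (fun i j => G (e i) (e j)).
split; last by move=> i; exists (e i).
split.
- by rewrite rep_sumE coef_mx_mxsub // ep gram_mxE gram_poly_support.
- by move=> i j /W_inj /enum_val_inj.
- by exists d.
- move=> i; rewrite lt0r psd_diag_ge0 // andbT.
  by have := enum_valP i; rewrite inE.
- by move=> K _; rewrite coef_mx_mxsub //; do 2!apply: psd_mxsub.
Qed.

Lemma admissible_gram_poly p k (zeta : 'I_k -> word) a (b : 'I_k -> 'I_k -> R) :
  admissible_rep p zeta a b -> p = gram_poly (coef_mx a b) zeta.
Proof. by case=> -> *; rewrite rep_sumE. Qed.

Lemma gram_poly_ext k (G : 'M[R]_k) (z1 z2 : 'I_k -> word) :
  z1 =1 z2 -> gram_poly G z1 = gram_poly G z2.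
Proof.
by move=> ez; apply: eq_bigr => i _; apply: eq_bigr => j _; rewrite !ez.
Qed.

(** An empty representation would represent 0, which has no degree. *)
Lemma admissible_gt0 p k (zeta : 'I_k -> word) a (b : 'I_k -> 'I_k -> R) :
  admissible_rep p zeta a b -> (0 < k)%N.
Proof.
case: k zeta a b => // zeta a b [ep _ [d degp _] _ _].
by move: degp; rewrite ep rep_sumE gram_poly0 => /has_degree_neq0.
Qed.

Lemma admissible_gram_like p k (zeta : 'I_k -> word) a (b : 'I_k -> 'I_k -> R) :
  admissible_rep p zeta a b -> gram_like p (coef_mx a b) (\col_i zeta i).
Proof.
move=> adm; have k_gt0 := admissible_gt0 adm.
case: adm => ep z_inj [d degp zd] a_gt0 /(psd_coef_mx k_gt0) pG.
have eW i : (\col_i zeta i : 'cV_k) i ord0 = zeta i by rewrite mxE.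
split=> //.
- by rewrite ep rep_sumE; apply: psd_sohs.
- by move=> i j; rewrite !eW => /z_inj.
- by exists d => // i; rewrite eW.
rewrite gram_mxE ep rep_sumE; apply: gram_poly_ext => i.
by rewrite eW.
Qed.

(** The degree bounds for p and q separately say nothing about p + q. Its degree
    is obtained from the block matrix, whose diagonal is positive. *)
Lemma admissible_block_gram_like p q k l
    (zeta : 'I_k -> word) a (b : 'I_k -> 'I_k -> R)
    (eta : 'I_l -> word) c (d : 'I_l -> 'I_l -> R) :
  admissible_rep p zeta a b -> admissible_rep q eta c d ->
  (forall i j, zeta i <> eta j) -> sohs (p + q) ->
  gram_like (p + q) (block_mx (coef_mx a b) 0 0 (coef_mx c d))
    (col_mx (\col_i zeta i) (\col_j eta j)).
Proof.
move=> admp admq disj sohs_pq.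
have kl_gt0 : (0 < k + l)%N by rewrite addn_gt0 (admissible_gt0 admp).
have [_ pG _ _ _] := admissible_gram_like admp.
have [_ pH _ _ _] := admissible_gram_like admq.
have [[_ z_inj _ a_gt0 _] [_ e_inj _ c_gt0 _]] := (admp, admq).
set G := block_mx _ _ _ _; set W := col_mx _ _.
have Wl i : W (lshift l i) ord0 = zeta i by rewrite col_mxEu mxE.
have Wr j : W (rshift k j) ord0 = eta j by rewrite col_mxEd mxE.
have W_inj : injective (fun i => W i ord0).
  move=> i j; case: (split_ordP i) => i' ->; case: (split_ordP j) => j' ->.
  - by rewrite !Wl => /z_inj ->.
  - by rewrite Wl Wr => /disj.
  - by rewrite Wl Wr => /esym /disj.
  - by rewrite !Wr => /e_inj ->.
have G_gt0 i : 0 < G i i.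
  case: (split_ordP i) => i' ->.
    by rewrite block_mxEul mxE eqxx.
  by rewrite block_mxEdr mxE eqxx.
have epq : p + q = gram_poly G (fun i => W i ord0).
  rewrite gram_poly_block (gram_poly_ext _ Wl) (gram_poly_ext _ Wr).
  by rewrite -(admissible_gram_poly admp) -(admissible_gram_poly admq).
split=> //.
- exact: psd_block.
- exists (\max_i fdeg (W i ord0)); first by rewrite epq; apply: gram_poly_degree.
  by move=> i; apply: (bigop.leq_bigmax (F := fun i => fdeg (W i ord0))).
by rewrite gram_mxE.
Qed.

End GramPoly.

Theorem theorem3p22 (R : realType) (n : nat)
    (f h ft : {malg R[{fmonom 'I_n}]}) :
  all_vars_essential f ->
  sohs_part f h ->
  sohs_extension f ft ->
  (gram_preserving_extension f h ft /\
   exists (k l : nat) (Gh : 'M[R]_k) (Gl : 'M[R]_l)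
     (Wk : 'cV[{fmonom 'I_n}]_k) (Wl : 'cV[{fmonom 'I_n}]_l),
     gram_preserving_via h ft (block_mx Gh 0 0 Gl) (col_mx Wk Wl)
       Gh Wk (@lshift k l) /\
     gram_like (ft - h) Gl Wl)
  <->
  (exists (k l : nat)
     (zeta : 'I_k -> {fmonom 'I_n}) (a : 'I_k -> R) (b : 'I_k -> 'I_k -> R)
     (eta : 'I_l -> {fmonom 'I_n}) (c : 'I_l -> R) (d : 'I_l -> 'I_l -> R),
     [/\ admissible_rep h zeta a b,
         admissible_rep (ft - h) eta c d
       & forall i j, zeta i <> eta j]).
Proof.
move=> _ part_h ext_ft; split.
  move=> [_ [k [l [Gh [Gl [Wk [Wl [[_ gft gh _ _] gr]]]]]]]].
  have [k' [zeta [a [b [admh zW]]]]] := gram_like_admissible gh.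
  have [l' [eta [c [d [admr eW]]]]] := gram_like_admissible gr.
  exists k', l', zeta, a, b, eta, c, d; split=> // i j.
  have [[i' ->] [j' ->]] := (zW i, eW j).
  rewrite -(col_mxEu Wk Wl) -(col_mxEd Wk Wl).
  by case: gft => _ _ W_inj _ _ /W_inj /eqP; rewrite eq_lrshift.
move=> [k [l [zeta [a [b [eta [c [d [admh admr disj]]]]]]]]].
have gram_via : gram_preserving_via h ft
    (block_mx (coef_mx a b) 0 0 (coef_mx c d))
    (col_mx (\col_i zeta i) (\col_j eta j))
    (coef_mx a b) (\col_i zeta i) (@lshift k l).
  split.
  - by rewrite (admissible_gt0 admh) -addn1 leq_add2l (admissible_gt0 admr).
  - rewrite -[ft](subrKC h); apply: admissible_block_gram_like => //.
    by rewrite subrKC; case: ext_ft.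
  - exact: admissible_gram_like.
  - by [].
  - split; apply/matrixP => i j; first by rewrite mxE block_mxEul.
    by rewrite [LHS]mxE col_mxEu.
split; first by split=> //; do 7!eexists; exact: gram_via.
do 6!eexists; split; first exact: gram_via.
exact: admissible_gram_like.
Qed.
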